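(* Let $p$ be a prime, let $G$ be a finite $p$-solvable group and let $P$ be a $p$-subgroup of $G$ (not necessarily Sylow). Let $\chi\in\operatorname{Irr}(G)$ such that $\chi(1)_p\ge|G:P|_p$. Then $\chi_P$ is a sum of characters induced from subgroups $Q\le P$ such that $\chi(1)_p=|G:Q|_p$. That is, there exist finitely many subgroups $Q_1,\ldots,Q_n\le P$ (not necessarily distinct) with $|G:Q_i|_p=\chi(1)_p$ for all $i$ and (complex) characters $\lambda_i$ of $Q_i$ such that $\chi_P=\sum_{i=1}^n\lambda_i^P$.
   Context: $\operatorname{Irr}(G)$ is the set of irreducible complex characters of $G$. $m_p$ denotes the $p$-part of a positive integer $m$, i.e. the largest power of $p$ dividing $m$. $\chi_P$ is the restriction of $\chi$ to $P$ and $\lambda^P$ is the character of $P$ induced from the character $\lambda$ of a subgroup of $P$. *)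

(* Defs.v *)
From mathcomp Require Import all_boot all_order all_fingroup all_algebra.
From mathcomp Require Import all_solvable all_field all_character.

Set Implicit Arguments.
Unset Strict Implicit.
Unset Printing Implicit Defensive.

Import GroupScope Order.TTheory GRing.Theory Num.Theory.

(* The terms of the series are normal in A, and not merely each in the next. *)
Definition p_pprime_factor (gT : finGroupType) (p : nat) (A V U : {set gT}) :=
  invariant_factor A V U && (p.-group (U / V) || p^'.-group (U / V)).

Definition p_solvable (gT : finGroupType) (p : nat) (G : {group gT}) : Prop :=
  exists2 s : seq {group gT},
    (p_pprime_factor p G).-series 1%G s & last 1%G s = G.

(* Values of class functions lie in algC; for a character phi, phi 1 is a
   natural number (cfdegK), so the truncation to nat loses nothing. *)
Definition cfdeg (gT : finGroupType) (G : {group gT}) (phi : 'CF(G)) : nat :=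
  Num.truncn (phi 1%g).

Lemma cfdegK (gT : finGroupType) (G : {group gT}) (phi : 'CF(G)) :
  phi \is a character -> ((cfdeg phi)%:R = phi 1%g :> algC)%R.
Proof. by move=> /Cnat_char1/truncnK. Qed.

(* Main.v *)
Require Import Defs.
From HB Require Import structures.
From mathcomp Require Import all_boot all_order all_fingroup all_algebra.
From mathcomp Require Import all_solvable all_field all_character.

Import GroupScope Order.TTheory GRing.Theory Num.Theory.

(** Put k = |G|_p / chi(1)_p.  A p-subgroup Q satisfies |G : Q|_p = chi(1)_p
    exactly when |Q| = k, and the hypothesis on P says that k <= |P|.  Since a
    character induced from Q is also induced from every subgroup between Q and
    P, it is enough to write chi_P as a sum of characters induced from
    subgroups of order at most k; this is the predicate [induced_sum].  In this
    weak form Mackey's formula makes the property inherited by smaller P, so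
    that P may be taken to be a Sylow subgroup, and carries it from psi to chi
    whenever chi is induced from a character psi of a subgroup T (then
    |T|_p / psi(1)_p is again k): [induced_sum_Res_Ind_sub].

    The proof is an induction on the length of a chain Z <= M <= ... <= G of
    normal subgroups of G whose factors are p-groups or p'-groups, where Z
    consists of elements represented by scalars in chi.  Let theta be an
    irreducible constituent of chi_M.  If theta is not G-invariant, chi is
    induced from the inertia group of theta by Clifford's correspondence, and
    the order of the group drops.  If theta is invariant, it extends after
    passing to a central extension f : E -> G ([invariant_irr_central_lift]):
    the intertwiners realising the invariance are a projective representation
    of G, and normalising their determinants makes its cocycle take finitely
    many values.  Gallagher's theorem then gives chi o f = psi * thetahat with
    thetahat an extension of theta and f^-1(M) inside the center of psi, so psi
    falls under the induction hypothesis with a shorter chain.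

    It remains to multiply by thetahat and to descend from E to G.  The degree
    of theta divides |M : Z|.  If M / Z is a p'-group, psi(1)_p = chi(1)_p and
    multiplication by thetahat is harmless by the projection formula.  If M / Z
    is a p-group, let S be a Sylow p-subgroup of E and D its intersection with
    f^-1(M).  As D acts by scalars in psi, D lies in every subgroup Q from which
    a summand of psi_S is induced ([norm_cfInd_support]); and thetahat_D is
    irreducible because M is the product of Z and f(D).  So thetahat_Q is an
    irreducible character of a p-group, hence a sum of characters induced from
    subgroups of index at least theta(1) ([monomial_pgroup]), which supplies the
    missing factor theta(1) ([induced_sum_twist]).  The descent works because
    the kernel of f restricted to S acts trivially, hence lies in every Q
    ([induced_sum_morphim]). *)

Set Implicit Arguments.
Unset Strict Implicit.
Unset Printing Implicit Defensive.

Local Open Scope ring_scope.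

(** * Sums of induced characters and the Mackey formula *)

(** Bounding the orders of the subgroups, instead of prescribing them, is what
    makes the predicate stable under restriction.  The inductive form avoids
    families of class functions on varying groups. *)
Inductive induced_sum (gT : finGroupType) (k : nat) (P : {group gT}) :
    'CF(P) -> Prop :=
| IndSum0 : induced_sum k (0 : 'CF(P))
| IndSumD (Q : {group gT}) (lambda : 'CF(Q)) (phi : 'CF(P)) :
    Q \subset P -> (#|Q| <= k)%N -> lambda \is a character ->
    induced_sum k phi -> induced_sum k ('Ind[P] lambda + phi).

Section InducedSum.
Variables (gT : finGroupType) (k : nat).
Implicit Types P Q R T G : {group gT}.

Lemma induced_sum_char P (phi : 'CF(P)) :
  induced_sum k phi -> phi \is a character.
Proof.
elim=> [|Q lambda psi _ _ Nlambda _ Npsi]; first exact: rpred0.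
by rewrite rpredD ?cfInd_char.
Qed.

Lemma induced_sumD P (phi psi : 'CF(P)) :
  induced_sum k phi -> induced_sum k psi -> induced_sum k (phi + psi).
Proof.
move=> Sphi Spsi; elim: Sphi => [|Q lambda xi sQP leQk Nlambda _].
  by rewrite add0r.
by rewrite -addrA; apply: IndSumD.
Qed.

Lemma induced_sum_sum P I (r : seq I) (A : pred I) (F : I -> 'CF(P)) :
  (forall i, A i -> induced_sum k (F i)) ->
  induced_sum k (\sum_(i <- r | A i) F i).
Proof.
move=> SF; apply: (big_ind (@induced_sum gT k P)) => //; first exact: IndSum0.
exact: induced_sumD.
Qed.

Lemma induced_sum_small P (phi : 'CF(P)) :
  (#|P| <= k)%N -> phi \is a character -> induced_sum k phi.
Proof.
move=> lePk Nphi; rewrite -[phi]addr0 -[phi in phi + _]cfInd_id.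
by apply: IndSumD => //; apply: IndSum0.
Qed.

Lemma induced_sum_Ind P R (phi : 'CF(R)) :
  R \subset P -> induced_sum k phi -> induced_sum k ('Ind[P] phi).
Proof.
move=> sRP; elim=> [|Q lambda psi sQR leQk Nlambda _ IH].
  by rewrite linear0; apply: IndSum0.
rewrite linearD /= cfIndInd //; apply: IndSumD => //.
exact: subset_trans sRP.
Qed.

(** Projection formula: an induced character times psi is induced from the
    product with the restriction of psi. *)
Lemma induced_sumM P (phi psi : 'CF(P)) :
  psi \is a character -> induced_sum k phi -> induced_sum k (phi * psi).
Proof.
move=> Npsi; elim=> [|Q lambda xi sQP leQk Nlambda _ IH].
  by rewrite mul0r; apply: IndSum0.
rewrite mulrDl -cfIndM //; apply: IndSumD => //.
by rewrite rpredM ?cfRes_char.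
Qed.

Lemma induced_sum_conj P (phi : 'CF(P)) x :
  induced_sum k phi -> induced_sum k (cfIsom (conj_isom P x) phi).
Proof.
elim=> [|Q lambda xi sQP leQk Nlambda _ IH].
  by rewrite linear0; apply: IndSum0.
rewrite linearD /= -(cfIndIsom (conj_isom P x) (conj_isom Q x)) //.
apply: IndSumD => //; rewrite ?conjSg ?cardJg ?cfIsom_char //.
Qed.

(** Counts the pairs (t, a) in T * P by the value of t * x * a: every element of
    the double coset is reached as often as there are elements in P :&: T :^ x. *)
Lemma sum_double_coset (T P : {group gT}) x (F : gT -> algC) :
  (forall t y, t \in T -> F (t * y)%g = F y) ->
  #|P :&: T :^ x|%:R * (\sum_(y in (T :* x * P)%g) F y)
    = #|T|%:R * (\sum_(a in P) F (x * a)%g).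
Proof.
move=> Finv; transitivity (\sum_(a in P) \sum_(y in (T :* (x * a))%g) F y).
  rewrite (exchange_big_dep (mem (T :* x * P)%g)) /=; last first.
    by move=> a y Pa; rewrite rcosetM => /rcosetP[z Tz ->]; apply: mem_mulg.
  rewrite mulr_sumr; apply: eq_bigr => y /mulsgP[_ b /rcosetP[t Tt ->] Pb ->].
  rewrite sumr_const mulr_natl; congr (_ *+ _).
  rewrite -(card_rcoset [group of P :&: T :^ x] b); apply: eq_card => a.
  rewrite mem_rcoset !inE groupMr ?groupV // -[RHS]topredE /=.
  congr (_ && _); rewrite mem_conjg mem_rcoset conjgE invgK.
  by rewrite -[RHS]groupV !invMg !invgK !mulgA [RHS]groupMr ?groupV.
rewrite mulr_sumr; apply: eq_bigr => a Pa.
rewrite -(card_rcoset T (x * a)) mulr_natl -sumr_const.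
by apply: eq_bigr => _ /rcosetP[t Tt ->]; apply: Finv.
Qed.

Lemma cfIsom_conjE T (psi : 'CF(T)) x h :
  cfIsom (conj_isom T x) psi h = psi (h ^ x^-1)%g.
Proof.
have [Th | T'h] := boolP (h \in T :^ x).
  rewrite mem_conjg in Th.
  by rewrite -{1}(conjgKV x h) -(cfIsomE (conj_isom T x)) ?conjgmE.
by rewrite !cfun0 // -mem_conjg.
Qed.

Lemma mem_double_coset T P x : x \in (T :* x * P)%g.
Proof. by rewrite -{1}[x]mulg1 mem_mulg ?rcoset_refl ?group1. Qed.

Lemma Mackey_decomposition G T P (psi : 'CF(T)) :
  T \subset G -> P \subset G ->
  'Res[P] ('Ind[G] psi)
    = \sum_(D in (fun x => T :* x * P)%g @: G)
        'Ind[P] ('Res[P :&: T :^ repr D] (cfIsom (conj_isom T (repr D)) psi)).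
Proof.
move=> sTG sPG; apply/cfun_inP=> g Pg.
rewrite sum_cfunE cfResE // cfIndE // (reindex_inj invg_inj) /=.
rewrite (eq_bigl [in G]) => [|x]; last by rewrite groupV.
rewrite (partition_big_imset (fun x => T :* x * P)%g) /= mulr_sumr.
apply: eq_bigr => _ /imsetP[x0 Gx0 ->].
set D := (_ * P)%g; set x := repr D.
have Dx0: x0 \in D by apply: mem_double_coset.
have Dx: x \in D by apply: mem_repr Dx0.
have defD y: y \in D -> (T :* y * P)%g = D.
  case/mulsgP=> _ b /rcosetP[t Tt ->] Pb ->.
  by rewrite !rcosetM rcoset_id // -mulgA lcoset_id.
have sDG: D \subset G by rewrite !mul_subG ?sub1set.
pose F y := psi (g ^ y^-1)%g.
have Finv t y: t \in T -> F (t * y)%g = F y.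
  by move=> Tt; rewrite /F invMg conjgM [LHS]cfunJ ?groupV.
have nz (Q : {group gT}) : #|Q|%:R != 0 :> algC by rewrite neq0CG.
have defF := sum_double_coset P x Finv; rewrite defD // in defF.
move/(canRL (mulKf (nz [group of P :&: T :^ x]))): defF => defF.
rewrite (eq_bigl [in D]) => [|y]; last first.
  apply/andP/idP=> [[Gy /eqP <-]|Dy]; first exact: mem_double_coset.
  by rewrite (subsetP sDG) ?defD.
rewrite [X in _ * X]defF mulrCA mulKf ?nz // cfIndE ?subsetIl //.
congr (_ * _); rewrite [RHS](reindex_inj invg_inj) /=.
apply: eq_big => [a | a Pa]; first by rewrite groupV.
have Pga: (g ^ a^-1)%g \in P by rewrite groupJ ?groupV.
have [Txa | T'xa] := boolP ((g ^ a^-1)%g \in T :^ x).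
  by rewrite cfResE ?subsetIr ?inE ?Pga // cfIsom_conjE /F invMg conjgM.
rewrite [RHS]cfun0 ?inE ?Pga // /F invMg conjgM cfun0 // -mem_conjg //.
Qed.

Lemma induced_sum_Res_Ind G T P (psi : 'CF(T)) :
  T \subset G -> P \subset G ->
  (forall x, x \in G -> induced_sum k
      ('Res[P :&: T :^ x] (cfIsom (conj_isom T x) psi))) ->
  induced_sum k ('Res[P] ('Ind[G] psi)).
Proof.
move=> sTG sPG Spsi; rewrite Mackey_decomposition //.
apply: induced_sum_sum => _ /imsetP[x0 Gx0 ->].
have Dx0: x0 \in (T :* x0 * P)%g by apply: mem_double_coset.
apply: induced_sum_Ind; rewrite ?subsetIl //; apply: Spsi.
apply: subsetP (mem_repr _ Dx0); rewrite !mul_subG ?sub1set //.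
Qed.

(** By Mackey, the restriction of an induced character is induced from
    intersections of R with conjugates of Q, whose orders do not exceed |Q|. *)
Lemma induced_sum_Res P R (phi : 'CF(P)) :
  R \subset P -> induced_sum k phi -> induced_sum k ('Res[R] phi).
Proof.
move=> sRP; elim=> [|Q lambda psi sQP leQk Nlambda _ IH].
  by rewrite linear0; apply: IndSum0.
rewrite linearD /=; apply: induced_sumD IH.
apply: induced_sum_Res_Ind => // x Px; apply: induced_sum_small.
  by rewrite (leq_trans _ leQk) // -(cardJg Q x) subset_leq_card ?subsetIr.
by rewrite cfRes_char ?cfIsom_char.
Qed.

(** The Mackey summand at x lives on P :&: T :^ x, which is conjugate to a
    p-subgroup of T, and conjugation preserves the property. *)
Lemma induced_sum_Res_Ind_sub G T P (psi : 'CF(T)) (p : nat) :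
  T \subset G -> P \subset G -> p.-group P ->
  (forall R, R \subset T -> p.-group R -> induced_sum k ('Res[R] psi)) ->
  induced_sum k ('Res[P] ('Ind[G] psi)).
Proof.
move=> sTG sPG pP Spsi; apply: induced_sum_Res_Ind => // x Gx.
pose R := (P :^ x^-1 :&: T)%G.
have defR: P :&: T :^ x = R :^ x by rewrite conjIg conjsgKV.
have /(induced_sum_conj x): induced_sum k ('Res[R] psi).
  apply: Spsi; rewrite ?subsetIr //.
  by rewrite (pgroupS (subsetIl _ _)) ?pgroupJ.
rewrite -(cfResIsom (conj_isom T x) (conj_isom R x)) ?subsetIr //.
by have /val_inj <-: (P :&: T :^ x)%G = (R :^ x)%G :> {set gT}.
Qed.

End InducedSum.

(** * Elements acting by scalars, and descent along surjections *)

Section Center.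
Variable gT : finGroupType.
Implicit Types G P Q D : {group gT}.

(** Equality in the triangle inequality: an element acting by a scalar on a sum
    acts by a scalar on each summand. *)
Lemma norm_char_add G (a b : 'CF(G)) x :
    a \is a character -> b \is a character ->
    `|(a + b) x| = (a + b) 1%g ->
  `|a x| = a 1%g /\ `|b x| = b 1%g.
Proof.
move=> Na Nb; rewrite !cfunE => eq_ab.
have [lea leb] := (char1_ge_norm x Na, char1_ge_norm x Nb).
have le_ab: a 1%g + b 1%g <= `|a x| + `|b x| by rewrite -eq_ab ler_normD.
split; apply/le_anti; rewrite ?lea ?leb /=.
  by rewrite -(lerD2r (b 1%g)) (le_trans le_ab) ?lerD2l.
by rewrite -(lerD2l (a 1%g)) (le_trans le_ab) ?lerD2r.
Qed.

Lemma cfker_char_add G (a b : 'CF(G)) x :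
    a \is a character -> b \is a character -> x \in G ->
  x \in cfker (a + b) -> x \in cfker a /\ x \in cfker b.
Proof.
move=> Na Nb Gx; rewrite !cfkerEchar ?rpredD // !inE Gx /= !cfunE => /eqP eq_ab.
pose F (c : bool) := if c then a x else b x.
pose H (c : bool) := if c then a 1%g else b 1%g.
have eqF: \sum_c F c = \sum_c H c by rewrite !big_bool.
have leF c : true -> `|F c| <= H c by case: c => _; apply: char1_ge_norm.
by split; apply/eqP; [apply: (normC_sum_upper leF eqF (i := true))
                     | apply: (normC_sum_upper leF eqF (i := false))].
Qed.

(** The value at z averages, over the conjugates of z, numbers of modulus at most
    lambda(1).  If z is not in Q, the conjugate z itself contributes 0, and the
    bound 'Ind lambda 1 cannot be attained. *)
Lemma norm_cfInd_support P Q (lambda : 'CF(Q)) z :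
    Q \subset P -> z \in P -> lambda \is a character -> lambda != 0 ->
  `|'Ind[P] lambda z| = 'Ind[P] lambda 1%g -> z \in Q.
Proof.
move=> sQP Pz Nl nzl; apply: contra_eqT => Q'z.
have l1_gt0 : 0 < lambda 1%g by rewrite char1_gt0.
rewrite lt_eqF // cfInd1 // cfIndE // normrM normfV normr_nat.
rewrite natf_indexg // mulrAC [X in _ < X]mulrC ltr_pM2l; last first.
  by rewrite invr_gt0 ltr0n cardG_gt0.
apply: le_lt_trans (ler_norm_sum _ _ _) _.
rewrite mulr_natl -sumr_const (bigD1 1%g) //= [X in _ < X](bigD1 1%g) //=.
rewrite conjg1 (cfun0 _ Q'z) normr0 ltr_leD //.
by apply: ler_sum => y _; apply: char1_ge_norm.
Qed.

End Center.

(** The induction formula for inflated characters speaks of characters of images,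
    so a character trivial on the kernel is transported through Q / ker f. *)
Lemma char_factors_morphim (aT rT : finGroupType) (P Q : {group aT})
    (f : {morphism P >-> rT}) (lambda : 'CF(Q)) :
    Q \subset P -> 'ker f \subset cfker lambda -> lambda \is a character ->
  exists2 mu : 'CF(f @* Q), mu \is a character & lambda = cfMorph mu.
Proof.
move=> sQP kerl Nl.
have skQ : 'ker f \subset Q := subset_trans kerl (cfker_sub lambda).
have [g injg img] := first_isom_loc f sQP.
have ek : 'ker_Q f = 'ker f by apply/setIidPr.
have nkQ : 'ker_Q f <| Q by rewrite ek (normalS skQ sQP (ker_normal f)).
have {}kerl: 'ker_Q f \subset cfker lambda by rewrite ek.
have isog : isom (Q / 'ker_Q f) (f @* Q) g by apply/isomP; rewrite img.
exists (cfIsom isog (lambda / 'ker_Q f)%CF).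
  by rewrite cfIsom_char cfQuo_char.
apply/cfun_inP=> x Qx; rewrite cfMorphE //.
have -> : f x = g (coset ('ker_Q f) x).
  have Nx := subsetP (normal_norm nkQ) x Qx.
  have /(_ _)/eqP := img [set x]; rewrite sub1set => /(_ Qx).
  rewrite quotient_set1 // !morphim_set1 ?(subsetP sQP) //; last first.
    exact: mem_quotient.
  by move/eqP/set1_inj.
by rewrite cfIsomE ?mem_quotient // cfQuoE.
Qed.

(** The kernel of f lies in the kernel of every summand 'Ind lambda, hence in the
    kernel of lambda and in Q; each summand is therefore inflated, and passing
    to f @* Q divides the order of Q by #|'ker f|. *)
Lemma induced_sum_morphim (aT rT : finGroupType) (P : {group aT})
    (f : {morphism P >-> rT}) k (phi : 'CF(f @* P)) :
  phi \is a character ->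
  induced_sum (#|'ker f| * k) (cfMorph phi) -> induced_sum k phi.
Proof.
suffices IH (xi : 'CF(P)) : induced_sum (#|'ker f| * k) xi ->
    'ker f \subset cfker xi ->
    exists2 psi : 'CF(f @* P), induced_sum k psi & xi = cfMorph psi.
  move=> Nphi /IH[|psi Spsi /cfMorph_inj-> //].
  by rewrite cfker_morph // subsetI subsetIl morphpreS ?sub1G.
elim=> [|Q lambda psi sQP leQk Nl Spsi IH].
  by exists 0; [apply: IndSum0 | rewrite linear0].
have Npsi := induced_sum_char Spsi.
move=> ker_sum; have [kerI kerpsi]:
    'ker f \subset cfker ('Ind[P] lambda) /\ 'ker f \subset cfker psi.
  by split; apply/subsetP=> x kx; have Px := subsetP (subsetIl _ _) x kx;
     have [] := cfker_char_add (cfInd_char P Nl) Npsi Px (subsetP ker_sum x kx).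
have [xi0 Sxi ->] := IH kerpsi.
have [-> | nzl] := eqVneq lambda 0.
  by exists xi0; rewrite // linear0 add0r.
rewrite cfker_Ind // in kerI; have {}kerI := subset_trans kerI (gcore_sub _ _).
have skQ : 'ker f \subset Q := subset_trans kerI (cfker_sub lambda).
have [mu Nmu ->] := char_factors_morphim sQP kerI Nl.
exists ('Ind[f @* P] mu + xi0); last by rewrite linearD /= cfIndMorph.
apply: IndSumD; rewrite ?morphimS //.
have := leQk; rewrite -(LagrangeI Q ('ker f)) (setIidPr skQ) leq_pmul2l //.
by rewrite card_morphim (setIidPr sQP).
Qed.

(** For f the projection of a central extension and P a Sylow subgroup of it: f is
    then defined on more than P, and the inflation of phi is a restriction. *)
Lemma induced_sum_im (aT rT : finGroupType) (P : {group aT}) (R : {group rT})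
    (D : {group aT}) (f : {morphism D >-> rT}) k (phi : 'CF(R)) (xi : 'CF(P)) :
  P \subset D -> f @* P = R -> phi \is a character ->
  {in P, forall x, xi x = phi (f x)} ->
  induced_sum (#|'ker_P f| * k) xi -> induced_sum k phi.
Proof.
move=> sPD defR Nphi eq_xi; pose g := restrm_morphism sPD f.
have eR : R = (g @* P)%G by apply: val_inj; rewrite /= restrmEsub.
rewrite -(ker_restrm sPD) => Sxi.
move: phi Nphi eq_xi {defR}; rewrite eR => phi Nphi eq_xi.
apply: (induced_sum_morphim (f := g)) => //; suff <-: xi = cfMorph phi by [].
by apply/cfun_inP=> x Px; rewrite eq_xi ?cfMorphE.
Qed.

(** * Clifford theory and irreducible characters of p-groups *)

Section Clifford.
Variable gT : finGroupType.
Implicit Types G P Q D H T : {group gT}.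

Lemma cfcenter_constt G H i (t : Iirr H) z :
    H \subset G -> z \in H -> t \in irr_constt ('Res[H] 'chi[G]_i) ->
  z \in 'Z('chi_i)%CF -> z \in 'Z('chi_t)%CF.
Proof.
move=> sHG Hz; have Gz := subsetP sHG z Hz.
rewrite !irr_cfcenterE //.
case/(constt_charP _ (cfRes_char _ (irr_char i))) => xi Nxi def_chi /eqP eqz.
apply/eqP; have [] := @norm_char_add _ _ _ _ z (irr_char t) Nxi => //.
by rewrite -def_chi !cfResE.
Qed.

Lemma Clifford_correspondence G H i (t : Iirr H) :
    H <| G -> t \in irr_constt ('Res[H] 'chi[G]_i) ->
  exists s : Iirr 'I_G['chi_t], 'chi_i = 'Ind[G] 'chi_s.
Proof.
move=> nsHG; rewrite -constt_Ind_Res => chi_t.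
have [irrA _ imA _ _] := constt_Inertia_bijection t nsHG.
move: chi_t; rewrite -imA => /imsetP[s As ->]; exists s.
by rewrite cfIirrE ?irrA.
Qed.

Lemma Ind_irr_constt_Res G H (s : Iirr H) i :
   'chi_i = 'Ind[G] 'chi_s -> s \in irr_constt ('Res[H] 'chi_i).
Proof.
by move=> def_chi; rewrite -constt_Ind_Res -def_chi constt_irr inE.
Qed.

Lemma Clifford_invariant G H i (t : Iirr H) :
    H <| G -> G \subset 'I['chi_t] -> t \in irr_constt ('Res[H] 'chi[G]_i) ->
  'Res[H] 'chi_i = '['Res[H] 'chi_i, 'chi_t] *: 'chi_t.
Proof.
move=> nsHG IGt /(Clifford_Res_sum_cfclass nsHG) {1}->.
by rewrite cfclass_invariant // big_seq1.
Qed.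

(** The weak form of the fact that p-groups are monomial.  If chi is not linear,
    there is A normal in Q containing the center Z of chi with index p.  A
    constituent t of chi_A has t(1)^2 <= p and t(1) dividing p, so t is linear;
    were it Q-invariant, A would act by scalars and be contained in Z.  Hence
    chi is induced from a proper subgroup. *)
Lemma monomial_pgroup (p : nat) Q i k :
    p.-group Q -> (#|Q|%:R <= k%:R * 'chi[Q]_i 1%g)%R ->
  induced_sum k 'chi_i.
Proof.
have [n] := ubnP #|Q|; elim: n Q i => // n IHn Q i leQn pQ lek.
have [lin | nlin] := eqVneq ('chi_i 1%g) 1.
  rewrite lin mulr1 ler_nat in lek.
  by apply: induced_sum_small; rewrite ?irr_char.
have nsZ : 'Z('chi_i)%CF <| Q := cfcenter_normal _.
have ltZ : 'Z('chi_i)%CF \proper Q.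
  rewrite properEneq cfcenter_sub andbT; apply: contraNneq nlin => eZ.
  have [/= le1 _] := irr1_bound i; rewrite eZ indexgg in le1.
  have := irr1_gt0 i; move: le1; rewrite irr1_degree -natrX ltr0n ler_nat.
  by case: (irr_degree _) => [|[|m]].
have pQZ : p.-group (Q / 'Z('chi_i)%CF)%g by apply: quotient_pgroup.
have [p_pr pdQ _] := pgroup_pdiv pQZ (etrans (quotient_neq1 nsZ) ltZ).
have lt0 : (0 < logn p #|(Q / 'Z('chi_i)%CF)%g|)%N.
  by rewrite logn_gt0 mem_primes p_pr cardG_gt0.
have [A' [_ nsA' oA']] := normal_pgroup pQZ (normal_refl _) lt0.
have [A defA sZA nsAQ] := inv_quotientN nsZ nsA'.
have sAQ := normal_sub nsAQ.
have [t chi_t] : exists t, t \in irr_constt ('Res[A] 'chi_i).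
  by apply: neq0_has_constt; rewrite Res_irr_neq0.
have [s def_chi] := Clifford_correspondence nsAQ chi_t.
have sTQ : 'I_Q['chi_t] \subset Q := Inertia_sub _ _.
have [eT | neT] := eqVneq 'I_Q['chi_t] (Q : {set gT}).
  (* If t is invariant, it is linear and chi_A is a multiple of it. *)
  have sZT : 'Z('chi_i)%CF \subset 'Z('chi_t)%CF.
    apply/subsetP=> z Zz; apply: (cfcenter_constt sAQ _ chi_t Zz).
    exact: subsetP sZA z Zz.
  have oA : #|A : 'Z('chi_i)%CF| = p.
    by rewrite -card_quotient ?(subset_trans sAQ) ?normal_norm // -defA oA' expn1.
  have le1 : ('chi_t 1%g ^+ 2 <= p%:R)%R.
    have [/= le1 _] := irr1_bound t; rewrite (le_trans le1) // ler_nat -oA.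
    by rewrite dvdn_leq ?indexgS.
  have dvd_t : ('chi_t 1%g %| p)%C.
    rewrite (dvdC_trans (dvd_irr1_index_center t)) // dvdC_nat -oA indexgS //.
  have t1 : 'chi_t 1%g = 1.
    move: le1 dvd_t; rewrite irr1_degree dvdC_nat -natrX ler_nat => le1.
    have [_ pdivs] := primeP p_pr; case/pdivs/pred2P=> [-> // | e]; move: le1.
    by rewrite e (leq_exp2l 2 1) ?(prime_gt1 p_pr).
  have : A \subset 'Z('chi_i)%CF.
    apply/subsetP=> a Aa; rewrite irr_cfcenterE ?(subsetP sAQ) //.
    have := Clifford_invariant nsAQ (introT setIidPl eT) chi_t.
    set e := '[_, _] => defA_chi; have e_ge0 : 0 <= e.
      by rewrite natr_ge0 ?Cnat_cfdot_char ?cfRes_char ?irr_char.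
    have lint : 'chi_t \is a linear_char by rewrite qualifE/= irr_char t1 /=.
    rewrite -!(cfResE _ sAQ) // defA_chi !cfunE normrM (ger0_norm e_ge0) t1.
    by rewrite normC_lin_char.
  move/subset_leq_card => leA; have := Lagrange sZA; rewrite oA => defAc.
  by move: leA; rewrite -defAc -[leqRHS]muln1 leq_pmul2l // leqNgt prime_gt1.
rewrite def_chi; apply: induced_sum_Ind => //; apply: IHn.
- by rewrite -ltnS (leq_trans _ leQn) // !ltnS proper_card // properEneq neT.
- exact: pgroupS pQ.
move: lek; rewrite def_chi cfInd1 // -(Lagrange sTQ) natrM mulrC mulrCA.
by rewrite ler_pM2l ?ltr0n ?indexg_gt0.
Qed.
End Clifford.

(** * Twisting by a character that stays irreducible *)

Section Twist.
Variable gT : finGroupType.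
Implicit Types G P Q D H T : {group gT}.

(** Since D acts by scalars in psi, it lies in every Q occurring in psi; thus theta
    is irreducible on Q, where being a sum of characters induced from subgroups
    of order at most |Q| / d reduces the bound from k * d to k. *)
Lemma induced_sum_twist (p : nat) P D (psi theta : 'CF(P)) k d :
    p.-group P -> D \subset P -> theta \is a character ->
    'Res[D] theta \in irr D -> theta 1%g = d%:R ->
    {in D, forall z, `|psi z| = psi 1%g} ->
  induced_sum (k * d) psi -> induced_sum k (psi * theta).
Proof.
move=> pP sDP Ntheta irr_theta theta1 psiD Spsi.
elim: Spsi psiD => [_|Q lambda xi sQP leQ Nl Sxi IH sumD].
  by rewrite mul0r; apply: IndSum0.
have Nxi := induced_sum_char Sxi.
have NInd := cfInd_char P Nl.
have IndD z : z \in D -> `|'Ind[P] lambda z| = 'Ind[P] lambda 1%g.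
  by move=> /sumD/norm_char_add[].
rewrite mulrDl; apply: induced_sumD; last first.
  by apply: IH => z /sumD/norm_char_add[].
have [-> | nzl] := eqVneq lambda 0.
  by rewrite linear0 mul0r; apply: IndSum0.
have sDQ : D \subset Q.
  apply/subsetP=> z Dz; apply: norm_cfInd_support sQP (subsetP sDP z Dz) Nl nzl _.
  exact: IndD.
rewrite -cfIndM //; apply: induced_sum_Ind => //.
rewrite mulrC; apply: induced_sumM => //.
have /irrP[i def_i] : 'Res[Q] theta \in irr Q.
  by apply: (@cfRes_irr_irr _ _ D); rewrite ?cfRes_char ?cfResRes.
rewrite def_i; apply: (monomial_pgroup (pgroupS sQP pP)).
by rewrite -def_i cfRes1 theta1 -natrM ler_nat.
Qed.

(** Elements of the center act by scalars of modulus 1. *)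
Lemma norm_cfcenterM G (chi : 'CF(G)) y a :
    chi \is a character -> chi 1%g != 0 -> y \in 'Z(chi)%CF -> a \in G ->
  `|chi (y * a)%g| = `|chi a|.
Proof.
move=> Nchi nz1 Zy Ga; have Gy := subsetP (cfcenter_sub chi) y Zy.
have := Zy; rewrite char_cfcenterE // => /eqP eq1.
move: Zy eq1 nz1; have [rG ->] := char_reprP Nchi.
rewrite cfcenter_repr => /setIdP[_ /is_scalar_mxP[c rGy]].
rewrite cfRepr1 !cfunE Gy Ga groupM //= repr_mxM // rGy.
rewrite !mulr1n mul_scalar_mx mxtraceZ mxtrace_scalar.
rewrite normrM -[c *+ _]mulr_natl normrM normr_nat.
move=> eq1 nz1; have -> : `|c| = 1; last by rewrite mul1r.
by apply: (mulfI nz1); rewrite eq1 mulr1.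
Qed.

(** The modulus of chi is constant on the cosets of Y, so the average of its square
    over D is the average over A, that is 1. *)
Lemma irr_Res_supplement (A D Y : {group gT}) (i : Iirr A) :
    D \subset A -> Y \subset 'Z('chi_i)%CF -> A :=: (Y * D)%g ->
  'Res[D] 'chi_i \in irr D.
Proof.
move=> sDA sYZ defA; rewrite irrEchar cfRes_char ?irr_char //=.
pose F y := `|'chi_i y| ^+ 2.
have sYA := subset_trans sYZ (cfcenter_sub _).
have Finv y a : y \in Y -> F (y * a)%g = F a.
  move=> Yy; rewrite /F; have [Aa | A'a] := boolP (a \in A).
    by rewrite norm_cfcenterM ?irr_char ?irr1_neq0 ?(subsetP sYZ).
  by rewrite !cfun0 // groupMl // (subsetP sYA).
have nz (Q : {group gT}) : #|Q|%:R != 0 :> algC by rewrite neq0CG.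
have := cfnorm_irr i; rewrite !(cfnormE (cfun_onG _)) => /(canRL (mulVKf (nz A))).
rewrite mulr1 => eqA.
have := sum_double_coset D 1%g Finv.
rewrite conjsg1 mulg1 -defA [X in _ * X]eqA.
have eAD : (#|A| * #|Y :&: D| = #|Y| * #|D|)%N by rewrite defA mul_cardG.
rewrite setIC mulrC -natrM eAD natrM => /(mulfI (nz Y)) eqD.
apply/eqP/(canLR (mulKf (nz D))); rewrite mulr1 eqD.
by apply: eq_bigr => a Da; rewrite mul1g cfResE.
Qed.
End Twist.

(** * Central extensions attached to cocycles *)

(** Additive notation: the values stand for exponents of a primitive
    (k + 1)-th root of unity. *)
Definition cocycle (aT : finGroupType) k (c : aT -> aT -> 'I_k.+1) :=
  forall x y z, c x y + c (x * y)%g z = c y z + c x (y * z)%g.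

Section CocycleExtension.
Variables (aT : finGroupType) (k : nat) (c : aT -> aT -> 'I_k.+1).
Hypotheses (cP : cocycle c) (c11 : c 1%g 1%g = 0).

Lemma cocycle1l x : c 1%g x = 0.
Proof.
have := cP 1%g 1%g x; rewrite !mul1g c11 add0r => /eqP.
by rewrite -subr_eq subrr => /eqP <-.
Qed.

Lemma cocycle1r x : c x 1%g = 0.
Proof.
have := cP x 1%g 1%g; rewrite !mulg1 c11 add0r => /eqP.
by rewrite eq_sym -subr_eq subrr => /eqP <-.
Qed.

End CocycleExtension.

(** The cocycle proofs are parameters of the type so that the group structure on
    pairs can be attached to it. *)
Definition cocycle_ext (aT : finGroupType) k (c : aT -> aT -> 'I_k.+1)
  (cP : cocycle c) (c11 : c 1%g 1%g = 0) : Type := (aT * 'I_k.+1)%type.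

Section CocycleGroup.
Variables (aT : finGroupType) (k : nat) (c : aT -> aT -> 'I_k.+1).
Hypotheses (cP : cocycle c) (c11 : c 1%g 1%g = 0).
Local Notation E := (cocycle_ext cP c11).

HB.instance Definition _ := Finite.copy E (aT * 'I_k.+1)%type.

Definition ext_mul (u v : E) : E := ((u.1 * v.1)%g, u.2 + v.2 + c u.1 v.1).
Definition ext_one : E := (1%g, 0).
Definition ext_inv (u : E) : E := (u.1^-1%g, - u.2 - c u.1^-1%g u.1).

Lemma ext_mulA : associative ext_mul.
Proof.
case=> [x a] [y b] [z d]; congr pair; rewrite /= ?mulgA //.
have := cP x y z; set u := c x y; set v := c y z; set w := c _ z; set r := c x _.
move=> eq_c.
by rewrite -!addrA; congr (_ + (_ + _)); rewrite [RHS]addrCA eq_c.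
Qed.

Lemma ext_mul1 : left_id ext_one ext_mul.
Proof. by case=> x a; rewrite /ext_mul /= mul1g add0r cocycle1l // addr0. Qed.

Lemma ext_mulV : left_inverse ext_one ext_inv ext_mul.
Proof.
by case=> x a; rewrite /ext_mul /= mulVg; congr pair; rewrite addrAC subrK addNr.
Qed.

HB.instance Definition _ := Finite_isGroup.Build E ext_mulA ext_mul1 ext_mulV.

End CocycleGroup.

(** * Lifting an invariant irreducible character to a central extension *)

Section Intertwiners.
Variables (gT : finGroupType) (G M : {group gT}) (d : nat).
Variable rM : mx_representation algC M d.
Hypotheses (nsMG : M <| G) (irrM : mx_irreducible rM).
Hypothesis invM : G \subset 'I[cfRepr rM].

Definition intertwines g (A : 'M[algC]_d) :=
  forall n, n \in M -> rM n *m A = A *m rM (n ^ g)%g.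

Let memJM g n : g \in G -> n \in M -> (n ^ g)%g \in M.
Proof. by move=> Gg; rewrite memJ_norm ?(subsetP (normal_norm nsMG)). Qed.

Lemma irr_repr_degree_gt0 : (0 < d)%N.
Proof. by have [_] := irrM; rewrite -mxrank_eq0 mxrank1 lt0n. Qed.

(** Invariance makes rM and its twist by g similar; dividing by a d-th root of the
    determinant normalises the similarity. *)
Lemma intertwiner_exists g : g \in G ->
  exists A, \det A = 1 /\ intertwines g A.
Proof.
move=> Gg.
have rgP : mx_repr M (fun n => rM (n ^ g)%g).
  split=> [|n m Mn Mm]; first by rewrite conj1g repr_mx1.
  by rewrite conjMg repr_mxM ?memJM.
pose rg := MxRepresentation rgP.
have /cfRepr_rsimP[B _ freeB defB] : cfRepr rM == cfRepr rg.
  apply/eqP/cfun_inP=> n Mn; rewrite [RHS]cfunE Mn /=.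
  rewrite -(inertia_valJ n (subsetP invM g Gg)) cfunE memJM //.
have nzB : \det B != 0 by rewrite -unitfE -unitmxE -row_free_unit.
have d_gt0 := irr_repr_degree_gt0.
pose z := d.-root (\det B).
have zd : z ^+ d = \det B by rewrite rootCK.
exists (z^-1 *: B); split; first by rewrite detZ exprVn zd mulVf.
by move=> n Mn; rewrite -scalemxAr -scalemxAl defB.
Qed.

Lemma intertwinesM g h A B : g \in G -> h \in G ->
  intertwines g A -> intertwines h B -> intertwines (g * h)%g (A *m B).
Proof.
by move=> Gg Gh iA iB n Mn; rewrite mulmxA iA // -!mulmxA iB ?memJM // conjgM.
Qed.

Lemma intertwines_repr n : n \in M -> intertwines n (rM n).
Proof. by move=> Mn m Mm; rewrite -!repr_mxM ?groupJ // -conjgC. Qed.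

(** Schur's lemma: A * B^-1 commutes with the irreducible representation rM. *)
Lemma intertwines_uniq g A B : g \in G ->
    \det B = 1 -> intertwines g A -> intertwines g B ->
  exists a, A = a *: B.
Proof.
move=> Gg detB iA iB; have uB : B \in unitmx by rewrite unitmxE detB unitr1.
have /is_scalar_mxP[a defa] : is_scalar_mx (A *m invmx B).
  apply: (mx_abs_irr_cent_scalar (groupC irrM)); apply/centgmxP=> n Mn.
  rewrite mulmxA iA // -!mulmxA; congr (_ *m _).
  by rewrite -[LHS](mulKmx uB) -[RHS](mulKmx uB) mulKVmx //
             [B *m (_ *m _)]mulmxA -iB ?mulmxK.
by exists a; rewrite -[A](mulmxKV uB) defa mul_scalar_mx.
Qed.

End Intertwiners.

(** Normalised intertwiners T g multiply up to d-th roots of unity, which gives a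
    cocycle with values in the roots of unity of order d * #|M|, and
    (g, i) |-> z ^+ i *: T g is a representation of the central extension E.
    The subgroup N is where this representation agrees with rM o f; it covers
    M because rM n is a multiple of T n by a scalar a with a ^+ d = \det (rM n),
    and this determinant is a root of unity of order dividing #|M|. *)
Lemma invariant_irr_central_lift (gT : finGroupType) (G M : {group gT})
    (t : Iirr M) :
    M <| G -> G \subset 'I['chi_t] ->
  exists (eT : finGroupType) (f : {morphism [set: eT] >-> gT}) (N : {group eT})
         (theta : 'CF([set: eT])),
    [/\ f @* [set: eT] = G, 'ker f \subset 'Z([set: eT]),
        N <| [set: eT], f @* N = M
      & theta \is a character /\ {in N, forall x, theta x = 'chi_t (f x)}].
Proof.
move=> nsMG; have /irr_reprP[[d rM] /= irrM ->] := mem_irr t => invM.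
have d_gt0 := irr_repr_degree_gt0 irrM.
(* The choice T 1 = 1 makes the cocycle normalised. *)
have exT (g : gT) : exists A : 'M[algC]_d,
    (g \in G -> \det A = 1 /\ intertwines rM g A) /\ (g = 1%g -> A = 1%:M).
  have [-> | ntg] := eqVneq g 1%g.
    exists 1%:M; split=> // _; split; first exact: det1.
    by move=> n Mn; rewrite mulmx1 mul1mx conjg1.
  have [Gg | notGg] := boolP (g \in G); last first.
    by exists 0; split=> [//| eg]; rewrite eg eqxx in ntg.
  have [A PA] := intertwiner_exists nsMG irrM invM Gg.
  by exists A; split=> // eg; rewrite eg eqxx in ntg.
have [T TP] := fin_all_exists exT.
have detT g : g \in G -> \det (T g) = 1 by case: (TP g) => PG _ /PG[].
have intT g : g \in G -> intertwines rM g (T g) by case: (TP g) => PG _ /PG[].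
have T1 : T 1%g = 1%:M by case: (TP 1%g) => _; apply.
have uT g : g \in G -> T g \in unitmx by move=> Gg; rewrite unitmxE detT ?unitr1.
pose k := (d * #|M|).-1.
have Dk : k.+1 = (d * #|M|)%N by rewrite prednK ?muln_gt0 ?d_gt0 ?cardG_gt0.
have [z prim_z] := C_prim_root_exists (ltn0Sn k).
have rootP a : a ^+ (d * #|M|)%N = 1 -> exists i : 'I_k.+1, a = z ^+ i.
  by rewrite -Dk => /(prim_rootP prim_z)[i]; exists i.
pose aT := subg_of G.
have exc (u : aT * aT) : exists i : 'I_k.+1,
    T (sgval u.1) *m T (sgval u.2) = z ^+ i *: T (sgval u.1 * sgval u.2)%g.
  case: u => x y /=.
  have [Gx Gy] := (subgP x, subgP y); have Gxy := groupM Gx Gy.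
  have iTT := intertwinesM nsMG Gx Gy (intT _ Gx) (intT _ Gy).
  have [a defa] := intertwines_uniq irrM Gxy (detT _ Gxy) iTT (intT _ Gxy).
  have [|i defi] := rootP a; last by exists i; rewrite -defi.
  have := congr1 (fun A => \det A) defa; rewrite det_mulmx detZ !detT // !mulr1.
  by rewrite exprM => <-; rewrite expr1n.
have [c' c'P] := fin_all_exists exc.
pose c x y := c' (x, y).
have cE x y : T (sgval x) *m T (sgval y) = z ^+ c x y *: T (sgval (x * y)%g).
  exact: (c'P (x, y)).
have zD (i j : 'I_k.+1) : z ^+ (i + j)%R = z ^+ i * z ^+ j.
  by rewrite -exprD /= prim_expr_mod.
have z_inj : injective (fun i : 'I_k.+1 => z ^+ i).
  move=> i j /eqP; rewrite (eq_prim_root_expr prim_z) !modn_small // => /eqP.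
  exact: val_inj.
have nzT g : g \in G -> T g != 0.
  by move=> Gg; rewrite -mxrank_eq0 mxrank_unit ?uT // -lt0n.
have z_scale (i j : 'I_k.+1) g :
  g \in G -> z ^+ i *: T g = z ^+ j *: T g -> i = j.
  move=> Gg /eqP; rewrite -subr_eq0 -scalerBl scaler_eq0 (negPf (nzT g Gg)) orbF.
  by rewrite subr_eq0 => /eqP/z_inj.
(* The cocycle identity is the associativity of the product of three T's. *)
have cP : cocycle c.
  move=> x y w; apply: z_scale (subgP (x * y * w)%g) _.
  rewrite !zD -[LHS]scalerA -cE scalemxAl -cE -mulmxA cE -scalemxAr cE.
  by rewrite scalerA mulgA.
have c11 : c 1%g 1%g = 0.
  apply: z_scale (group1 G) _; rewrite expr0 scale1r.
  by have := cE 1%g 1%g; rewrite mulg1 /= !T1 mul1mx => <-.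
pose E := cocycle_ext cP c11.
pose f0 (u : E) := sgval u.1.
have f0M : {in [set: E] &, {morph f0 : u v / (u * v)%g}} by [].
pose f := Morphism f0M.
pose TE (u : E) := z ^+ u.2 *: T (f u).
have TE_P : mx_repr [set: E] TE.
  split=> [|u v _ _]; first by rewrite /TE expr0 scale1r T1.
  rewrite /TE -scalemxAl -scalemxAr scalerA [X in _ = _ *: X](cE u.1 v.1) scalerA.
  by rewrite -!zD.
pose rE := MxRepresentation TE_P.
have TEM u v : TE (u * v)%g = TE u *m TE v by apply: TE_P.2; rewrite inE.
have fM u v : f (u * v)%g = (f u * f v)%g by [].
pose N0 := [set u : E | (f u \in M) && (TE u == rM (f u))].
have N0_P : group_set N0.
  apply/group_setP; split=> [|u v].
    by rewrite inE morph1 group1 repr_mx1 (TE_P.1) eqxx.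
  rewrite !inE => /andP[Mu /eqP eu] /andP[Mv /eqP ev].
  by rewrite TEM fM groupM //= eu ev repr_mxM.
pose N := Group N0_P.
have fG u : f u \in G by apply: subgP.
exists E, f, N, (cfRepr rE); split.
- apply/eqP; rewrite eqEsubset; apply/andP; split; apply/subsetP=> g.
    by case/morphimP=> u _ _ ->; apply: fG.
  move=> Gg; apply/morphimP; exists ((subg G g, 0) : E); rewrite ?inE //.
  by rewrite /= /f0 subgK.
- apply/subsetP=> u /mker fu1; apply/centerP; split=> [|v _]; rewrite ?inE //.
  have u1 : u.1 = 1%g by apply: subg_inj.
  congr pair; rewrite /= u1 ?mulg1 ?mul1g //.
  by rewrite cocycle1l // cocycle1r // [u.2 + _]addrC.
- rewrite /normal subsetT; apply/subsetP=> x _; rewrite inE.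
  apply/subsetP=> _ /imsetP[u Nu ->]; move: Nu; rewrite !inE => /andP[Mu /eqP eu].
  have Muf : f (u ^ x)%g \in M.
    by rewrite morphJ ?inE // memJ_norm // (subsetP (normal_norm nsMG)).
  rewrite Muf /=; apply/eqP.
  have uTx : rE x \in unitmx by apply: repr_mx_unit; rewrite inE.
  apply: (can_inj (mulKmx uTx)); rewrite /= -TEM -conjgC TEM eu /TE.
  by rewrite -scalemxAr -scalemxAl intT // morphJ ?inE.
- apply/eqP; rewrite eqEsubset; apply/andP; split; apply/subsetP=> n.
    by case/morphimP=> u _; rewrite inE => /andP[Mu _] ->.
  move=> Mn; have Gn := subsetP (normal_sub nsMG) n Mn.
  have iM := intertwines_repr rM Mn.
  have [a defa] := intertwines_uniq irrM Gn (detT _ Gn) iM (intT _ Gn).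
  have [|i defi] := rootP a.
    have := congr1 (fun A => \det A) defa; rewrite detZ detT // mulr1 exprM => <-.
    have <- m : \det (rM (n ^+ m)%g) = \det (rM n) ^+ m.
      elim: m => [|m IHm]; first by rewrite repr_mx1 det1.
      by rewrite expgS repr_mxM ?groupX // det_mulmx IHm exprS.
    by rewrite expg_cardG // repr_mx1 det1.
  apply/morphimP; exists ((subg G n, i) : E); rewrite ?inE //.
    by rewrite /TE /= /f0 subgK // Mn -defi -defa /=.
  by rewrite /= /f0 subgK.
- split=> [|u]; first exact: cfRepr_char.
  by rewrite inE => /andP[Mu /eqP eu]; rewrite !cfunE inE Mu /= -eu.
Qed.

(** * Normal chains with p- and p'-factors *)

(** Indices rather than quotients, since these are what degrees divide. *)
Definition p_factor (gT : finGroupType) (p : nat) (G A B : {group gT}) :=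
  [&& A \subset B, A <| G, B <| G & p.-nat #|B : A| || p^'.-nat #|B : A|].

Lemma p_factor_setI (gT : finGroupType) (p : nat) (G T A B : {group gT}) :
  T \subset G -> p_factor p G A B -> p_factor p T (A :&: T)%G (B :&: T)%G.
Proof.
move=> sTG /and4P[sAB nsAG nsBG pAB].
have nsI (H : {group gT}) : H <| G -> (H :&: T)%G <| T.
  by move=> nsHG; have := normalGI sTG nsHG; rewrite setIC.
rewrite /p_factor setSI ?nsI //=.
have dv : (#|B :&: T : A :&: T| %| #|B : A|)%N.
  have -> : A :&: T = B :&: T :&: A by rewrite setIAC (setIidPr sAB).
  have nBA : B \subset 'N(A) := subset_trans (normal_sub nsBG) (normal_norm nsAG).
  rewrite indexgI -!card_quotient // ?(subset_trans (subsetIl _ _)) //.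
  by rewrite cardSg ?quotientS ?subsetIl.
by case/orP: pAB => pAB; apply/orP; [left | right]; apply: pnat_dvd pAB.
Qed.

Lemma index_morphpre (aT rT : finGroupType) (D : {group aT})
    (f : {morphism D >-> rT}) (A B : {group rT}) :
  A \subset B -> B \subset f @* D -> #|f @*^-1 B : f @*^-1 A| = #|B : A|.
Proof.
move=> sAB sBf; have := Lagrange (morphpreS f sAB); have := Lagrange sAB.
rewrite (card_morphpre (subset_trans sAB sBf)) (card_morphpre sBf) => <- /eqP.
by rewrite -mulnA !eqn_pmul2l ?cardG_gt0 // => /eqP.
Qed.

Lemma p_factor_morphpre (aT rT : finGroupType) (p : nat)
    (f : {morphism [set: aT] >-> rT}) (G A B : {group rT}) :
  f @* [set: aT] = G -> p_factor p G A B ->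
  p_factor p [set: aT] (f @*^-1 A)%G (f @*^-1 B)%G.
Proof.
move=> fE /and4P[sAB nsAG nsBG pAB].
have nsI (H : {group rT}) : H <| G -> (f @*^-1 H)%G <| [set: aT].
  move=> nsHG; rewrite /normal subsetT /=; apply/subsetP=> x _; rewrite inE.
  have Gfx : f x \in G by rewrite -fE mem_morphim ?inE.
  apply/subsetP=> _ /imsetP[y Hy ->]; move: Hy; rewrite !inE /= => Hy.
  by rewrite morphJ ?inE // memJ_norm ?(subsetP (normal_norm nsHG)).
rewrite /p_factor morphpreS ?nsI //=.
by rewrite index_morphpre // fE normal_sub.
Qed.

Lemma Gallagher_factor (gT : finGroupType) (E N : {group gT}) (t : Iirr N)
    (c e : Iirr E) :
    N <| E -> 'Res[N] 'chi_c = 'chi_t -> t \in irr_constt ('Res[N] 'chi_e) ->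
  exists2 b : Iirr E, N \subset cfker 'chi_b & 'chi_e = 'chi_b * 'chi_c.
Proof.
move=> nsNE resc; rewrite -constt_Ind_Res.
have [irr_mul _ -> _] := constt_Ind_ext nsNE resc.
case/codomP=> b ->; exists (mod_Iirr b).
  by rewrite mod_IirrE // cfker_mod.
by rewrite cfIirrE ?irr_mul.
Qed.

Lemma cfdeg_nat (gT : finGroupType) (G : {group gT}) (phi : 'CF(G)) n :
  phi 1%g = n%:R -> cfdeg phi = n.
Proof. by rewrite /cfdeg => ->; rewrite natrK. Qed.

(** The bound k is free, subject to k * chi(1)_p >= |G|_p, so that no division
    is needed. *)
Definition induced_restrictions (gT : finGroupType) (p : nat) (G : {group gT})
    (chi : 'CF(G)) :=
  forall k (P : {group gT}), P \subset G -> p.-group P ->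
    (#|G|`_p <= k * (cfdeg chi)`_p)%N -> induced_sum k ('Res[P] chi).

(** * The step for an invariant constituent *)

Lemma center_sub_cfcenter (gT : finGroupType) (G : {group gT}) (i : Iirr G) :
  'Z(G) \subset 'Z('chi_i)%CF.
Proof. by rewrite -cap_cfcenter_irr bigcap_inf. Qed.

(** D maps onto a Sylow p-subgroup of the p-group A / Y. *)
Lemma Sylow_supplement (gT : finGroupType) (p : nat) (A D Y : {group gT}) :
  p.-Sylow(A) D -> Y <| A -> p.-nat #|A : Y| -> A :=: (Y * D)%g.
Proof.
move=> sylD nsYA pAY; have [sYA nYA] := andP nsYA.
have sDA := pHall_sub sylD; have nYD := subset_trans sDA nYA.
have pAq : p.-group (A / Y) by rewrite /pgroup card_quotient.
have eDY : (D / Y = A / Y)%g.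
  by apply: (@pHall_id _ p) => //; apply: quotient_pHall sylD.
by rewrite -quotientK // eDY quotientGK.
Qed.

(** Factor the inflation of chi to the central extension as chi_b times the lift
    theta of 'chi_t, apply the hypothesis to chi_b, multiply by theta, and
    descend.  A Sylow p-subgroup of the extension is m = |ker f|_p times larger
    than its image, and chi_b has lost the factor d = theta(1) of the degree,
    whence the bound m * k * d_p for chi_b. *)
Lemma induced_restrictions_invariant (gT : finGroupType) (p : nat)
    (G M Z : {group gT}) (i : Iirr G) (t : Iirr M) :
    p_factor p G Z M -> Z \subset 'Z('chi_i)%CF ->
    t \in irr_constt ('Res[M] 'chi_i) -> G \subset 'I['chi_t] ->
    (forall (eT : finGroupType) (f : {morphism [set: eT] >-> gT})
            (b : Iirr [set: eT]),
        f @* [set: eT] = G -> f @*^-1 M \subset 'Z('chi_b)%CF ->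
     induced_restrictions p 'chi_b) ->
  induced_restrictions p 'chi_i.
Proof.
move=> pf; have /and4P[sZM nsZG nsMG pZM] := pf.
move=> sZi chi_t IGt IH k P sPG pP lek.
have [eT [f [N [theta [fE kerf nsNE fN [Ntheta thetaN]]]]]] :=
  invariant_irr_central_lift nsMG IGt.
have {fE} eG : G = (f @* [set: eT])%G by apply: val_inj.
have {fN} eM : M = (f @* N)%G by apply: val_inj.
subst G M; set E := [set: eT]%G.
have irrN : cfMorph 'chi_t \in irr N by rewrite cfMorph_irr ?subsetT ?mem_irr.
have resN : 'Res[N] theta = cfMorph 'chi_t.
  by apply/cfun_inP=> x Nx; rewrite cfResE ?subsetT // cfMorphE ?subsetT ?thetaN.
have /irrP[c def_c] : theta \in irr E.
  by apply: (@cfRes_irr_irr _ _ N); rewrite ?resN.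
have /irrP[e def_e] : cfMorph 'chi_i \in irr E by rewrite cfMorph_irr ?subsetT ?mem_irr.
have /irrP[t' def_t'] := irrN.
have constt_e : t' \in irr_constt ('Res[N] 'chi_e).
  have -> : 'Res[N] 'chi_e = cfMorph ('Res[f @* N] 'chi_i).
    apply/cfun_inP=> x Nx; rewrite cfResE ?subsetT // -def_e !cfMorphE ?subsetT ?inE //.
    by rewrite cfResE ?morphimS ?subsetT // mem_morphim ?inE.
  by rewrite irr_consttE -def_t' cfMorph_iso ?subsetT.
have [b kerb def_b] : exists2 b : Iirr E, N \subset cfker 'chi_b
    & 'chi_e = 'chi_b * 'chi_c.
  by apply: Gallagher_factor nsNE _ constt_e; rewrite -def_c resN.
(* f^-1(M) is the product of N, which acts trivially, and of the central ker f. *)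
have Zb : f @*^-1 (f @* N) \subset 'Z('chi_b)%CF.
  rewrite morphimK ?subsetT // mul_subG //.
    by rewrite (subset_trans kerf) ?center_sub_cfcenter.
  by rewrite (subset_trans kerb) // normal_sub ?cfker_center_normal.
have Sb := IH eT f b (erefl _) Zb.
(* Every p-subgroup of G lies in the image S of a Sylow subgroup of E. *)
have [S0 sylS0] := Sylow_exists p E.
have [x Gx sPx] : exists2 x, x \in f @* E & P \subset (f @* S0 :^ x)%g.
  by apply: Sylow_subJ sPG pP; apply: morphim_pSylow sylS0; apply: subsetT.
have [y Ey _ defx] := morphimP Gx.
pose S := (S0 :^ y)%G; have sylS : p.-Sylow(E) S by rewrite pHallJ.
have sPS : P \subset f @* S by rewrite morphimJ // -defx.
have pS := pHall_pgroup sylS; have sSE : S \subset E by apply: subsetT.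
have sfS : f @* S \subset f @* E by rewrite morphimS.
rewrite -(cfResRes _ sPS sfS); apply: induced_sum_Res => //.
have Nchi : 'Res[f @* S] 'chi_i \is a character by rewrite cfRes_char ?irr_char.
apply: (induced_sum_im (f := f) (P := S) (xi := 'Res[S] 'chi_b * 'Res[S] theta)) => //.
  move=> u Su; have Eu := subsetP sSE u Su.
  rewrite cfResE // ?mem_morphim // -(cfMorphE _ (subxx _)) // def_e def_b.
  by rewrite !cfunE !cfResE // def_c.
set m := #|'ker_S f|.
have nskE : 'ker f <| E by apply: ker_normal.
have def_m : m = (#|'ker f|`_p)%N.
  by rewrite /m setIC (card_Hall (Sylow_setI_normal nskE sylS)).
pose d := cfdeg 'chi_t; pose n := cfdeg 'chi_b.
have th1 : theta 1%g = d%:R.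
  by rewrite thetaN // morph1 cfdegK ?irr_char.
have n1 : 'chi_b 1%g = n%:R by rewrite cfdegK ?irr_char.
have n_gt0 : (0 < n)%N by rewrite -(ltr0n algC) -n1 irr1_gt0.
have d_gt0 : (0 < d)%N by rewrite -(ltr0n algC) cfdegK ?irr_char ?irr1_gt0.
have def_deg : cfdeg 'chi_i = (n * d)%N.
  apply: cfdeg_nat; rewrite natrM -n1 -th1 def_c.
  by rewrite -(cfMorph1 'chi_i) def_e def_b cfunE.
have Sb' : induced_sum (m * k * d`_p) ('Res[S] 'chi_b).
  apply: Sb => //; rewrite -/n.
  have -> : #|E| = (#|'ker f| * #|f @* E|)%N.
    by rewrite card_morphim setIid Lagrange ?normal_sub.
  rewrite partnM ?cardG_gt0 // -def_m -!mulnA leq_mul2l; apply/orP; right.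
  by rewrite [(d`_p * _)%N]mulnC -partnM // -def_deg.
have sZt : Z \subset 'Z('chi_t)%CF.
  apply/subsetP=> z Zz; have Mz := subsetP sZM z Zz.
  exact: cfcenter_constt (normal_sub nsMG) Mz chi_t (subsetP sZi z Zz).
have dvd_d : (d %| #|f @* N : Z|)%N.
  apply: (@dvdn_trans #|f @* N : 'Z('chi_t)%CF|); last exact: indexgS.
  by have := dvd_irr1_index_center t; rewrite -(cfdegK (irr_char t)) dvdC_nat.
case/orP: pZM => pZM.
  have ed : (d`_p)%N = d by apply: part_pnat_id; apply: pnat_dvd pZM.
  rewrite ed in Sb'.
  pose A := (f @*^-1 (f @* N))%G; pose D := (A :&: S)%G; pose Y := (f @*^-1 Z)%G.
  have /and4P[sYA nsYE nsAE _] : p_factor p E Y A by apply: p_factor_morphpre pf.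
  have nsYA : Y <| A by apply: normalS sYA (subsetT _) nsYE.
  have pAY : p.-nat #|A : Y| by rewrite index_morphpre // morphimS ?subsetT.
  have sDA : D \subset A by apply: subsetIl.
  apply: (induced_sum_twist (p := p) (D := D) (d := d)) => //.
  - exact: subsetIr.
  - by rewrite cfRes_char.
  - have sNA : N \subset A by rewrite -sub_morphim_pre ?subsetT.
    have /irrP[a def_a] : 'Res[A] theta \in irr A.
      apply: (@cfRes_irr_irr _ _ N); rewrite ?cfRes_char //.
      by rewrite cfResRes ?subsetT // resN.
    rewrite cfResRes ?subsetIr // -(cfResRes _ sDA) ?subsetT // def_a.
    apply: (irr_Res_supplement (Y := Y)) => //.
      (* Up to the central ker f, an element of Y lies in N, where theta is
         'chi_t o f; and Z acts by scalars in 'chi_t. *)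
      have sYZ : Y \subset 'Z('chi_c)%CF.
        apply/subsetP=> u /morphpreP[_ Zfu].
        have /morphimP[v Ev Nv eq_uv] := subsetP sZM _ Zfu.
        have /rcosetP[w kw ->] : u \in 'ker f :* v.
          by apply/rcoset_kerP; rewrite ?inE.
        apply: groupM.
          by rewrite (subsetP (center_sub_cfcenter c)) ?(subsetP kerf).
        rewrite irr_cfcenterE ?inE // -def_c thetaN // th1 -eq_uv.
        rewrite /d cfdegK ?irr_char // -irr_cfcenterE ?(subsetP sZt) //.
        exact: subsetP sZM _ Zfu.
      apply/subsetP=> u Yu; have Au := subsetP sYA u Yu.
      have := subsetP sYZ u Yu; rewrite irr_cfcenterE ?(subsetP (subsetT A)) //.
      rewrite irr_cfcenterE // -def_a -def_c.
      by rewrite !cfResE ?subsetT.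
    exact: Sylow_supplement (Sylow_setI_normal nsAE sylS) nsYA pAY.
  - by rewrite cfRes1.
  move=> z /setIP[Az Sz]; rewrite cfRes1 cfResE //.
  by apply/eqP; rewrite -irr_cfcenterE ?inE // (subsetP Zb).
have ed : (d`_p)%N = 1%N by apply: part_p'nat; apply: pnat_dvd pZM.
rewrite ed muln1 in Sb'; apply: induced_sumM => //.
by rewrite cfRes_char.
Qed.

(** * Induction along the chain *)

Lemma induced_restrictions_linear (gT : finGroupType) (p : nat) (G : {group gT})
    (i : Iirr G) :
  'chi_i 1%g = 1 -> induced_restrictions p 'chi_i.
Proof.
move=> lin k P sPG pP; rewrite (cfdeg_nat (n := 1%N)) // partn1 muln1 => lek.
apply: induced_sum_small; last by rewrite cfRes_char ?irr_char.
apply: leq_trans lek; rewrite -(part_pnat_id pP) dvdn_leq ?part_gt0 //.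
by rewrite partn_dvd ?cardSg.
Qed.

(** |G|_p / chi(1)_p does not change when chi is replaced by the character of T
    that induces it. *)
Lemma induced_restrictions_Ind (gT : finGroupType) (p : nat) (G T : {group gT})
    (i : Iirr G) (s : Iirr T) :
  T \subset G -> 'chi_i = 'Ind[G] 'chi_s ->
  induced_restrictions p 'chi_s -> induced_restrictions p 'chi_i.
Proof.
move=> sTG def_i Ss k P sPG pP lek; rewrite def_i.
apply: (induced_sum_Res_Ind_sub sTG sPG pP) => R sRT pR.
apply: Ss => //.
have gt0 : (0 < cfdeg 'chi_s)%N by rewrite -(ltr0n algC) cfdegK ?irr_char ?irr1_gt0.
have deg_i : cfdeg 'chi_i = (#|G : T| * cfdeg 'chi_s)%N.
  by apply: cfdeg_nat; rewrite natrM cfdegK ?irr_char // def_i cfInd1.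
move: lek; rewrite deg_i -(Lagrange sTG) !partnM ?indexg_gt0 ?cardG_gt0 //.
by rewrite mulnC mulnCA leq_pmul2l ?part_gt0.
Qed.

(** The outer induction on the length of the chain handles invariant constituents,
    as the central extension may be larger than G; the inner induction on #|G|
    handles the inertia group, whose chain has the same length. *)
Lemma chain_induced_restrictions (p n : nat) :
  forall (gT : finGroupType) (G Z : {group gT}) s (i : Iirr G),
    size s = n -> Z <| G -> Z \subset 'Z('chi_i)%CF ->
    path (p_factor p G) Z s -> last Z s = G ->
  induced_restrictions p 'chi_i.
Proof.
elim: n => [|n IHn] gT G Z s i.
  move/size0nil-> => _ + _ /= eG; rewrite eG => sGZ.
  apply: induced_restrictions_linear.
  have eZ : 'Z('chi_i)%CF = G by apply/eqP; rewrite eqEsubset cfcenter_sub.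
  have := dvd_irr1_index_center i; rewrite eZ indexgg -(cfdegK (irr_char i)).
  by rewrite dvdC_nat dvdn1 => /eqP->.
have [m] := ubnP #|G|; elim: m G Z s i => // m IHm G Z s i leGm sz nsZG sZi.
case: s sz => //= M s [sz] /andP[pf chain_s] last_s.
have /and4P[sZM _ nsMG _] := pf.
have [t chi_t] : exists t, t \in irr_constt ('Res[M] 'chi_i).
  by apply: neq0_has_constt; rewrite Res_irr_neq0.
have [s' def_i] := Clifford_correspondence nsMG chi_t.
have sTG : 'I_G['chi_t] \subset G := Inertia_sub _ _.
have [eT | neT] := eqVneq 'I_G['chi_t] (G : {set gT}).
  apply: (induced_restrictions_invariant pf sZi chi_t (introT setIidPl eT)).
  move=> aT f b fE Zb.
  (* The first factor has been absorbed by the center of 'chi_b. *)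
  apply: (IHn aT _ (f @*^-1 M)%G [seq (f @*^-1 A)%G | A <- s]) => //.
  - by rewrite size_map.
  - by have /and4P[] := p_factor_morphpre fE pf.
  - by apply: homo_path chain_s => A B; apply: p_factor_morphpre.
  rewrite last_map last_s; apply: val_inj => /=.
  by rewrite -fE morphimGK ?subsetT.
set T := 'I_G['chi_t]%G in s' def_i sTG.
apply: (induced_restrictions_Ind sTG def_i).
have sMT : M \subset T by apply: sub_Inertia; apply: normal_sub.
have sZT := subset_trans sZM sMT.
apply: (IHm T Z [seq (A :&: T)%G | A <- M :: s]).
- by rewrite -ltnS (leq_trans _ leGm) // ltnS proper_card // properEneq neT.
- by rewrite size_map /= sz.
- exact: normalS nsZG.
- have cst := Ind_irr_constt_Res def_i.
  apply/subsetP=> z Zz; have Tz := subsetP sZT z Zz.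
  exact: cfcenter_constt sTG Tz cst (subsetP sZi z Zz).
- have eZ : (Z :&: T)%G = Z by apply: val_inj; apply/setIidPl.
  have chain : path (p_factor p G) Z (M :: s) by rewrite /= pf.
  have := homo_path (f := fun A : {group gT} => (A :&: T)%G) _ chain.
  by rewrite eZ; apply=> A B; apply: p_factor_setI.
have /= -> := last_map (fun A : {group gT} => (A :&: T)%G) s M.
by rewrite last_s; apply: val_inj; apply/setIidPr.
Qed.

(** * Subgroups of prescribed order *)

Lemma p_solvable_chain (gT : finGroupType) (p : nat) (G : {group gT}) :
  p_solvable p G ->
  exists2 s : seq {group gT}, path (p_factor p G) 1%G s & last 1%G s = G.
Proof.
case=> s; rewrite /= => chain last_s; exists s => //.
suffices [] : path (p_factor p G) 1%G s /\ 1%G \subset G by [].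
elim: s (1%G : {group gT}) chain last_s => [V _ /= <- // | U s IHs V /=].
case/andP=> /andP[/and3P[nVG nUG nsVU] pVU] chain last_s.
have [chain_s sUG] := IHs U chain last_s; have sVU := normal_sub nsVU.
have sVG := subset_trans sVU sUG; split=> //; rewrite chain_s andbT.
rewrite /p_factor sVU /normal sVG sUG nVG nUG /=.
by move: pVU; rewrite /pgroup card_quotient ?normal_norm.
Qed.

(** Normalizers grow in p-groups, so Q can be enlarged by a factor p at a time. *)
Lemma pgroup_intermediate (gT : finGroupType) (p r : nat) (P Q : {group gT}) :
    p.-group P -> Q \subset P -> (#|Q| <= p ^ r <= #|P|)%N ->
  exists R : {group gT}, [/\ Q \subset R, R \subset P & #|R| = (p ^ r)%N].
Proof.
move=> pP; have [n] := ubnP (#|P| - #|Q|); elim: n Q => // n IHn Q ltn sQP.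
case/andP; rewrite leq_eqVlt => /orP[/eqP eQ _ | ltQ leP]; first by exists Q.
have ltQP : Q \proper P.
  by rewrite properEcard sQP (leq_trans ltQ).
have := nilpotent_proper_norm (pgroup_nil pP) ltQP => ltQN.
have nsQN : Q <| 'N_P(Q) by apply: normalSG.
have pNQ : p.-group ('N_P(Q) / Q)%g.
  by apply/quotient_pgroup/(pgroupS (subsetIl _ _) pP).
have [p_pr pdN _] := pgroup_pdiv pNQ (etrans (quotient_neq1 nsQN) ltQN).
have lt0 : (0 < logn p #|('N_P(Q) / Q)%g|)%N.
  by rewrite logn_gt0 mem_primes p_pr cardG_gt0.
have [A' [_ nsA' oA']] := normal_pgroup pNQ (normal_refl _) lt0.
have [A defA sQA nsAN] := inv_quotientN nsQN nsA'.
have sAP : A \subset P := subset_trans (normal_sub nsAN) (subsetIl _ _).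
have oA : #|A| = (#|Q| * p)%N.
  rewrite -(Lagrange sQA) -card_quotient -?defA ?oA' //.
  by rewrite (subset_trans (normal_sub nsAN)) // subsetIr.
have ltQA : (#|Q| < #|A|)%N by rewrite oA ltn_Pmulr ?prime_gt1.
have [||R [sAR sRP oR]] := IHn A _ sAP.
- by rewrite -ltnS (leq_trans _ ltn) // ltnS ltn_sub2l // proper_card.
- rewrite leP andbT oA.
  have [e oQ] := p_natP (pgroupS sQP pP).
  move: ltQ; rewrite oQ ltn_exp2l ?prime_gt1 // => ltr.
  by rewrite -expnSr leq_exp2l ?prime_gt1.
by exists R; rewrite (subset_trans sQA).
Qed.

(** Every nonzero lambda is induced up to a subgroup of order exactly p ^ r; the
    pairs (subgroup, character) are collected in a list of dependent pairs. *)
Lemma induced_sum_exact (gT : finGroupType) (p r : nat) (P : {group gT})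
    (phi : 'CF(P)) :
    p.-group P -> (p ^ r <= #|P|)%N -> induced_sum (p ^ r) phi ->
  exists n (Q : 'I_n -> {group gT}) (lambda : forall i, 'CF(Q i)),
    [/\ forall i, Q i \subset P, forall i, #|Q i| = (p ^ r)%N,
        forall i, lambda i \is a character /\ lambda i <> 0
      & phi = \sum_(i < n) 'Ind[P] (lambda i)].
Proof.
move=> pP leP Sphi.
pose good (u : {Q : {group gT} & 'CF(Q)}) :=
  [/\ tag u \subset P, #|tag u| = (p ^ r)%N, tagged u \is a character
    & tagged u <> 0].
pose u0 : {Q : {group gT} & 'CF(Q)} := Tagged _ (0 : 'CF(P)).
have [L goodL ->] : exists2 L, forall j, (j < size L)%N -> good (nth u0 L j)
    & phi = \sum_(u <- L) 'Ind[P] (tagged u).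
  elim: Sphi => [|Q lambda psi sQP leQ Nl _ [L goodL ->]].
    by exists [::] => [//|]; rewrite big_nil.
  have [-> | nzl] := eqVneq lambda 0.
    by exists L; rewrite // linear0 add0r.
  have [|R [sQR sRP oR]] := pgroup_intermediate (r := r) pP sQP.
    by rewrite leQ.
  pose u : {Q : {group gT} & 'CF(Q)} := Tagged _ ('Ind[R] lambda).
  exists (u :: L); last by rewrite big_cons /= cfIndInd.
  case=> [_ | j]; last exact: goodL.
  split=> //=; first exact: cfInd_char.
  by apply/eqP; rewrite cfInd_eq0.
have {}goodL (j : 'I_(size L)) : good (tnth (in_tuple L) j).
  by rewrite (tnth_nth u0); apply: goodL.
exists (size L), (fun j => tag (tnth (in_tuple L) j)),
  (fun j => tagged (tnth (in_tuple L) j)).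
split=> [j|j|j|]; try by have [] := goodL j.
by rewrite big_tnth.
Qed.

Theorem corollary2 (gT : finGroupType) (p : nat) (G P : {group gT})
    (chi : 'CF(G)) :
  prime p -> p_solvable p G ->
  P \subset G -> p.-group P ->
  chi \in irr G ->
  (#|G : P|`_p <= (cfdeg chi)`_p)%N ->
  exists (n : nat) (Q : 'I_n -> {group gT}) (lambda : forall i, 'CF(Q i)),
    [/\ forall i, Q i \subset P,
        forall i, (#|G : Q i|`_p = (cfdeg chi)`_p)%N,
        forall i, lambda i \is a character /\ lambda i <> 0%R
      & ('Res[P] chi = \sum_(i < n) 'Ind[P] (lambda i))%R].
Proof.
move=> p_pr /p_solvable_chain[s chain last_s] sPG pP /irrP[i ->{chi}] leP.
set d := cfdeg 'chi_i in leP *.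
have d_dvd : (d`_p %| #|G|`_p)%N.
  rewrite partn_dvd ?cardG_gt0 // -dvdC_nat.
  by have := dvd_irr1_cardG i; rewrite -(cfdegK (irr_char i)).
have d_gt0 : (0 < d`_p)%N by rewrite part_gt0.
have [r def_r] : exists r, (#|G|`_p %/ d`_p = p ^ r)%N.
  have [|r def_r] := @p_natP p (#|G|`_p %/ d`_p); last by exists r.
  exact: pnat_dvd (dvdn_div d_dvd) (part_pnat _ _).
have oG : (#|G|`_p = p ^ r * d`_p)%N by rewrite -def_r divnK.
have index_p (Q : {group gT}) : Q \subset P -> (#|G|`_p = #|Q| * #|G : Q|`_p)%N.
  move=> sQP; rewrite -(Lagrange (subset_trans sQP sPG)) partnM //.
  by rewrite (part_pnat_id (pgroupS sQP pP)).
have leP' : (p ^ r <= #|P|)%N.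
  by rewrite -(leq_pmul2r d_gt0) -oG (index_p P) // leq_mul2l leP orbT.
have S_chi : induced_sum (p ^ r) ('Res[P] 'chi_i).
  apply: (chain_induced_restrictions (erefl (size s)) _ _ chain last_s) => //.
  - exact: normal1.
  - exact: sub1G.
  by rewrite -/d -oG.
have [n [Q [lambda [sQ oQ Nl eq_chi]]]] := induced_sum_exact pP leP' S_chi.
exists n, Q, lambda; split=> // j.
have := index_p (Q j) (sQ j); rewrite oG oQ => /eqP.
by rewrite eqn_pmul2l ?expn_gt0 ?prime_gt0 // => /eqP.
Qed.
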